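(* Let $\mathbf{K}$ be a convex body in $\mathbb{R}^2$. If $\mathcal{F}$ is an NS-family of three positive homothetic copies of $\mathbf{K}$, with homothety ratios $\tau_1,\tau_2,\tau_3$, respectively, then there is a translate of $\left(\frac{2}{3}+\frac{2}{3\sqrt{3}}\right)\left(\sum_{i=1}^3\tau_i\right)\mathbf{K}$ containing $\bigcup\mathcal{F}$. Furthermore, the constant $\frac{2}{3}+\frac{2}{3\sqrt{3}}$ is the smallest real number with this property (i.e., the smallest real number $\mu$ such that for every convex body $\mathbf{K}$ in $\mathbb{R}^2$ and every NS-family $\mathcal{F}$ of three positive homothetic copies of $\mathbf{K}$ with homothety ratios $\tau_1,\tau_2,\tau_3$, some translate of $\mu\left(\sum_{i=1}^3\tau_i\right)\mathbf{K}$ contains $\bigcup\mathcal{F}$).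
   Context: A convex body in $\mathbb{R}^2$ is a compact convex subset of $\mathbb{R}^2$ with non-empty interior. A positive homothetic copy of $\mathbf{K}$ with homothety ratio $\tau>0$ is a set $\mathbf{x}+\tau\mathbf{K}$ with $\mathbf{x}\in\mathbb{R}^2$. A finite family $\mathcal{F}$ of at least two positive homothetic copies of $\mathbf{K}$ in $\mathbb{R}^2$ is called a non-separable family, in short an NS-family, if every line that intersects $\operatorname{conv}\left(\bigcup\mathcal{F}\right)$ intersects a member of $\mathcal{F}$ (equivalently, no line disjoint from $\bigcup\mathcal{F}$ strictly separates some members of $\mathcal{F}$ from all the other members).
   Formalization: Minimality is claimed only among real numbers μ ≥ 0: read literally over all reals it fails, since for every very negative μ the set μ(Στ_i)K is a large reflected copy of K, a translate of which contains the union, so there is no smallest such real. *)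

(* Defs.v *)
From HB Require Import structures.
From mathcomp Require Import all_boot all_order all_algebra.
From mathcomp Require Import all_classical all_reals all_analysis.

Set Implicit Arguments.
Unset Strict Implicit.
Unset Printing Implicit Defensive.

Import Order.TTheory GRing.Theory Num.Theory.
Import numFieldNormedType.Exports.

Local Open Scope classical_set_scope.
Local Open Scope ring_scope.

Definition convex_body (R : realType) (K : set 'rV[R]_2) : Prop :=
  [/\ compact K, convex_set K & K° !=set0].

Definition convex_hull (R : realType) (A : set 'rV[R]_2) : set 'rV[R]_2 :=
  smallest (fun C : set 'rV[R]_2 => convex_set C) A.

Definition line (R : realType) (L : set 'rV[R]_2) : Prop :=
  exists p v : 'rV[R]_2, v != 0 /\ L = [set p + t *: v | t in [set: R]].

(* The translate by [x] of [t K]; no sign condition is imposed on [t]. *)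
Definition homothet (R : realType) (K : set 'rV[R]_2) (x : 'rV[R]_2) (t : R) :
    set 'rV[R]_2 :=
  [set x + t *: z | z in K].

Definition positive_homothet (R : realType) (K : set 'rV[R]_2) (t : R)
    (A : set 'rV[R]_2) : Prop :=
  0 < t /\ exists x : 'rV[R]_2, A = homothet K x t.

(* Families are indexed: two members may coincide as sets. *)
Definition ns_family (R : realType) (K : set 'rV[R]_2) (I : finType)
    (F : I -> set 'rV[R]_2) : Prop :=
  [/\ (2 <= #|I|)%N,
      forall i : I, exists t : R, positive_homothet K t (F i) &
      forall L : set 'rV[R]_2, line L ->
        L `&` convex_hull (\bigcup_i F i) !=set0 ->
        exists i : I, L `&` F i !=set0].

Definition ns3_covering_constant (R : realType) (mu : R) : Prop :=
  forall (K : set 'rV[R]_2) (F : 'I_3 -> set 'rV[R]_2) (tau : 'I_3 -> R),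
    convex_body K -> ns_family K F ->
    (forall i : 'I_3, positive_homothet K (tau i) (F i)) ->
    exists x : 'rV[R]_2,
      \bigcup_i F i `<=` homothet K x (mu * \sum_(i < 3) tau i).

(* Main.v *)
Require Import Defs.
From HB Require Import structures.
From mathcomp Require Import all_boot all_order all_algebra.
From mathcomp Require Import all_classical all_reals all_analysis.
From mathcomp Require Import ring lra.

(** Write the members as F_i = x_i + tau_i K, put mu = 2/3 + 2/(3 sqrt 3) and
    lam = mu (tau_1 + tau_2 + tau_3).

    Upper bound.  A point y with y in x_i - (lam - tau_i) K for all i gives the
    translate y + lam K that contains every F_i, because
    (lam - tau_i) K + tau_i K = lam K.  If those three compact convex sets have
    no common point, separating a compact convex set from the origin in
    R^2 x R^2 yields normals n_1 + n_2 + n_3 = 0 such that the sum of the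
    support values of F_r in direction n_r exceeds lam H, where H is the sum of
    the support values of K (common_point_or_normals).  In effect K is replaced
    by the triangle with normals n_r circumscribed about it, and only the
    3 x 3 matrix t of the support values of F_j in direction n_r remains.  Its
    entries add up to (tau_1 + tau_2 + tau_3) H, since the n_r cancel the
    translations.  Non-separability says that F_i meets the convex hull of the
    other two members (ns_members_meet); the values of the n_r at a common
    point have sum zero, which constrains t.  Under these constraints the trace
    of t is at most mu times the sum of its entries (trace_le), hence at most
    lam H: a contradiction.

    The matrix inequality.  Up to two mirror-image orientations and some easy
    mixed cases, elimination of the mixing parameters (gap_product) leaves
    positive A, B, C and e with
    L >= 3 p + 10 e + 9 e^2 / p, where p = A + B + C and L is the trace,
    and e is to be bounded by kap L, where mu = 1 / (1 - kap).  The condition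
    kap (3 p^2 + 10 e p + 9 e^2) >= e p says that a binary quadratic form is
    nonnegative, and kap is the root of its discriminant: 8 kap^2 + 20 kap = 1.
    This is where sqrt 3 comes from.

    Lower bound.  Equality in all steps describes three equal triangles, each
    of which touches one side of the large triangle and touches the convex hull
    of the other two at a single point (covering_constant_lower). *)

Set Implicit Arguments.
Unset Strict Implicit.
Unset Printing Implicit Defensive.

Import Order.TTheory GRing.Theory Num.Theory.
Import numFieldNormedType.Exports.

Local Open Scope classical_set_scope.
Local Open Scope ring_scope.

(** * Three indices *)

Local Notation i1 := (ord0 : 'I_3).
Local Notation i2 := (lift ord0 ord0 : 'I_3).
Local Notation i3 := (lift ord0 (lift ord0 ord0) : 'I_3).

Lemma ord3P (i : 'I_3) : [\/ i = i1, i = i2 | i = i3].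
Proof.
case: i => [[|[|[|m]]] lt3]; last by [].
- by constructor 1; exact: val_inj.
- by constructor 2; exact: val_inj.
- by constructor 3; exact: val_inj.
Qed.

Lemma sum3 (V : nmodType) (f : 'I_3 -> V) : \sum_i f i = f i1 + f i2 + f i3.
Proof. by rewrite !big_ord_recl big_ord0 addr0 addrA. Qed.

(** * The extremal problem for support values *)

(** The two bounds on d force s to be at least (d - b) / a, and the second one
    bounds y below by (d - s a) / (1 - s), an increasing function of s when
    a < d; its value at (d - b) / a is the quotient in the conclusion. *)
Lemma gap_product (R : realFieldType) (a b d y s : R) :
  0 <= s -> s <= 1 -> a < d -> b < d ->
  d <= s * a + b -> d <= s * a + (1 - s) * y ->
  0 < a + b - d /\ a * b <= y * (a + b - d).
Proof.
move=> s0 s1 ad bd hb hy.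
have sa0 : 0 < s * a by lra.
have a0 : 0 < a.
  by rewrite ltNge; apply/negP => /(mulr_ge0_le0 s0); rewrite leNgt sa0.
have s1' : 0 < 1 - s.
  rewrite subr_gt0 lt_neqAle s1 andbT.
  by apply: contraTneq hy => ->; rewrite -ltNge; lra.
have gap : a * (1 - s) <= a + b - d by lra.
have gap0 : 0 < a * (1 - s) by rewrite mulr_gt0.
split; first exact: lt_le_trans gap.
have hya : d - a <= (y - a) * (1 - s) by lra.
have ya : 0 < y - a by rewrite -(pmulr_lgt0 _ s1'); lra.
have : a * (d - a) <= (y - a) * (a + b - d).
  apply: le_trans (_ : (y - a) * (a * (1 - s)) <= _).
    by rewrite mulrCA ler_pM2l.
  by rewrite ler_pM2l.
lra.
Qed.

(** The difference of the two sides is a sum over the pairs {X, Y} of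
    {A, B, C}, with third element Z, of (X - Y)^2 / (X Y) times a nonnegative
    factor. *)
Lemma sum_prod_div_ge (R : realFieldType) (A B C e : R) :
  0 < A -> 0 < B -> 0 < C -> 0 <= e ->
  (A + B + C) ^+ 2 + 6 * e * (A + B + C) + 9 * e ^+ 2 <=
  ((A + e) * (B + e) / C + (B + e) * (C + e) / A + (C + e) * (A + e) / B)
    * (A + B + C).
Proof.
move=> A0 B0 C0 e0; set p := A + B + C.
have p0 : 0 < p by rewrite !addr_gt0.
have nn X Y Z : 0 < X -> 0 < Y -> 0 < Z ->
    0 <= (X - Y) ^+ 2 / (X * Y) * (p * Z / 2 + e * p + e ^+ 2).
  move=> X0 Y0 Z0; apply: mulr_ge0.
    by rewrite divr_ge0 ?sqr_ge0 // ltW // mulr_gt0.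
  by rewrite !addr_ge0 ?exprn_ge0 ?divr_ge0 // mulr_ge0 // ltW.
rewrite -subr_ge0.
apply: le_trans (addr_ge0 (addr_ge0 (nn A B C A0 B0 C0) (nn B C A B0 C0 A0))
  (nn C A B C0 A0 B0)) _.
rewrite le_eqVlt; apply/orP; left; apply/eqP; rewrite /p; field.
by rewrite !gt_eqF.
Qed.

(** The core of the extremal problem: the excess e = 2 d - (a + b + c) is a
    fraction of L.  Writing a, b, c, d through e and the three gaps
    A = b + c - d, B = c + a - d, C = a + b - d, [gap_product] bounds x, y, z
    below, and their sum is L + d. *)
Lemma excess_le (R : realFieldType) (k L d a b c x y z s1 s2 s3 : R) :
  0 <= k -> 8 * k ^+ 2 + 20 * k = 1 -> 0 <= L ->
  0 <= a -> 0 <= b -> 0 <= c ->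
  0 <= s1 <= 1 -> 0 <= s2 <= 1 -> 0 <= s3 <= 1 -> x + y + z = L + d ->
  d <= s1 * a + b -> d <= s1 * a + (1 - s1) * y ->
  d <= s2 * b + c -> d <= s2 * b + (1 - s2) * z ->
  d <= s3 * c + a -> d <= s3 * c + (1 - s3) * x ->
  2 * d - (a + b + c) <= k * L.
Proof.
move=> k0 kE L0 a0 b0 c0 /andP[s10 s11] /andP[s20 s21] /andP[s30 s31] sE.
move=> hb hy hc hz ha hx.
have kL0 : 0 <= k * L by rewrite mulr_ge0.
have [e0|e0] := lerP (2 * d - (a + b + c)) 0; first exact: le_trans kL0.
have sa : s1 * a <= a by rewrite ler_piMl.
have sb : s2 * b <= b by rewrite ler_piMl.
have sc : s3 * c <= c by rewrite ler_piMl.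
have ad : a < d by lra.
have bd : b < d by lra.
have cd : c < d by lra.
(* From here on [a], [b] and [c] are all smaller than [d], and the quantity
   to bound, [e], is positive. *)
have [C0 yC] := gap_product s10 s11 ad bd hb hy.
have [A0 zA] := gap_product s20 s21 bd cd hc hz.
have [B0 xB] := gap_product s30 s31 cd ad ha hx.
set e := 2 * d - _ in e0 *.
set C := a + b - d in C0 yC; set A := b + c - d in A0 zA.
set B := c + a - d in B0 xB.
have aE : a = B + C + e by rewrite /B /C /e; lra.
have bE : b = C + A + e by rewrite /A /C /e; lra.
have cE : c = A + B + e by rewrite /A /B /e; lra.
have dE : d = A + B + C + 2 * e by rewrite /A /B /C /e; lra.
have p0 : 0 < A + B + C by lra.
have split U V W : 0 < W ->
    (V + W + e) * (W + U + e) / W = (U + V + W + 2 * e) + (U + e) * (V + e) / W.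
  by move=> W0; field; rewrite gt_eqF.
have {}yC : (A + B + C + 2 * e) + (A + e) * (B + e) / C <= y.
  by rewrite -split // ler_pdivrMr // -aE -bE.
have {}zA : (B + C + A + 2 * e) + (B + e) * (C + e) / A <= z.
  by rewrite -split // ler_pdivrMr // -bE -cE.
have {}xB : (C + A + B + 2 * e) + (C + e) * (A + e) / B <= x.
  by rewrite -split // ler_pdivrMr // -cE -aE.
have Lp := sum_prod_div_ge A0 B0 C0 (ltW e0).
move: ((A + e) * (B + e) / C) ((B + e) * (C + e) / A) ((C + e) * (A + e) / B)
  yC zA xB Lp => X Y Z yC zA xB Lp.
move: p0 Lp; set p := A + B + C => p0 Lp.
have XYZ : X + Y + Z <= L - 2 * p - 4 * e by rewrite /p; lra.
have {}Lp : 3 * p ^+ 2 + 10 * e * p + 9 * e ^+ 2 <= L * p.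
  have := ler_wpM2r (ltW p0) XYZ; lra.
rewrite -(ler_pM2r p0) -mulrA; apply: le_trans (ler_wpM2l k0 Lp).
have k0' : 0 < k.
  by rewrite lt_neqAle k0 andbT; apply: contra_eqN kE => /eqP <-; lra.
rewrite -subr_ge0.
(* [kE] makes the discriminant vanish, so the form is a square over [12 k]. *)
rewrite (_ : _ - _ = (6 * k * p + (10 * k - 1) * e) ^+ 2 / (12 * k)).
  by rewrite divr_ge0 ?sqr_ge0 // mulr_ge0.
have -> : (6 * k * p + (10 * k - 1) * e) ^+ 2 =
  12 * k * (k * (3 * p ^+ 2 + 10 * e * p + 9 * e ^+ 2) - e * p)
   + (1 - (8 * k ^+ 2 + 20 * k)) * e ^+ 2 by ring.
by rewrite kE subrr mul0r addr0 [RHS]mulrC mulKf // gt_eqF // mulr_gt0.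
Qed.

(** One of the two orientations of the extremal problem: the constraints of
    [excess_le] in terms of a = x - x', b = y - y', c = z - z' and
    d = x + y + z - L. *)
Lemma cyclic_bound (R : realFieldType) (k L x y z y' z' x' s1 s2 s3 : R) :
  0 <= k -> 8 * k ^+ 2 + 20 * k = 1 -> 0 <= L ->
  0 <= s1 <= 1 -> 0 <= s2 <= 1 -> 0 <= s3 <= 1 ->
  x' <= x -> y' <= y -> z' <= z ->
  s1 * x' + (1 - s1) * x + y' + z <= L ->
  s1 * x' + (1 - s1) * x + s1 * y + z <= L ->
  s2 * y' + (1 - s2) * y + z' + x <= L ->
  s2 * y' + (1 - s2) * y + s2 * z + x <= L ->
  s3 * z' + (1 - s3) * z + x' + y <= L ->
  s3 * z' + (1 - s3) * z + s3 * x + y <= L ->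
  x + y + z + y' + z' + x' <= (2 + k) * L.
Proof.
move=> k0 kE L0 s1P s2P s3P xx yy zz h1 h1' h2 h2' h3 h3'.
suff : 2 * (x + y + z - L) - ((x - x') + (y - y') + (z - z')) <= k * L by lra.
by apply: (@excess_le _ k L (x + y + z - L) (x - x') (y - y') (z - z') x y z
  s1 s2 s3) => //; lra.
Qed.

(** Here t r j is the support value of member j in direction r, where the three
    directions have sum zero: member i meets the convex hull of members j and l
    at a point where the directions take the values g r. *)
Definition support_meets (R : realFieldType) (t : 'I_3 -> 'I_3 -> R)
    (i j l : 'I_3) :=
  exists (s : R) (g : 'I_3 -> R), [/\ 0 <= s <= 1, \sum_r g r = 0 &
    forall r, g r <= t r i /\ g r <= (1 - s) * t r j + s * t r l].

(** In terms of the deficits t r r - t r j the claim bounds their sum by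
    (2 + k) L, where L is the trace.  The deficits next to a diagonal entry in
    cyclic order are x, y, z, and the others are x', y', z'. *)
Lemma trace_le (R : realFieldType) (k : R) (t : 'I_3 -> 'I_3 -> R) :
  0 <= k -> 8 * k ^+ 2 + 20 * k = 1 ->
  (forall i j l, (forall m, [\/ m = i, m = j | m = l]) ->
     support_meets t i j l) ->
  0 <= \sum_r t r r ->
  (1 - k) * \sum_r t r r <= \sum_r \sum_j t r j.
Proof.
move=> k0 kE tP.
have [|s1 [g1 [s1P]]] := tP i1 i2 i3; first exact: ord3P.
have [|s2 [g2 [s2P]]] := tP i2 i3 i1.
  move=> m.
  by case: (ord3P m) => ->; [constructor 3|constructor 1|constructor 2].
have [|s3 [g3 [s3P]]] := tP i3 i1 i2.
  move=> m.
  by case: (ord3P m) => ->; [constructor 2|constructor 3|constructor 1].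
have -> : \sum_r \sum_j t r j = t i1 i1 + t i1 i2 + t i1 i3 +
    (t i2 i1 + t i2 i2 + t i2 i3) + (t i3 i1 + t i3 i2 + t i3 i3).
  by rewrite !sum3.
rewrite !sum3.
move=> g30 g3P g20 g2P g10 g1P.
move: (g1P i1) (g1P i2) (g1P i3) (g2P i1) (g2P i2) (g2P i3)
  (g3P i1) (g3P i2) (g3P i3).
move: {g1P g2P g3P} (g1 i1) (g1 i2) (g1 i3) g10 (g2 i1) (g2 i2) (g2 i3) g20
  (g3 i1) (g3 i2) (g3 i3) g30.
move: {tP} (t i1 i1) (t i1 i2) (t i1 i3) (t i2 i1) (t i2 i2) (t i2 i3)
   (t i3 i1) (t i3 i2) (t i3 i3).
move=> t11 t12 t13 t21 t22 t23 t31 t32 t33.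
move=> a1 b1 c1 e1 a2 b2 c2 e2 a3 b3 c3 e3.
move=> [_ A1] [B1 B1'] [C1 C1'].
move=> [A2 A2'] [_ B2] [C2 C2'] [A3 A3'] [B3 B3'] [_ C3].
set L := t11 + t22 + t33 => L0.
pose x := t11 - t12; pose x' := t11 - t13.
pose y' := t22 - t21; pose y := t22 - t23.
pose z := t33 - t31; pose z' := t33 - t32.
suff : x + y + z + y' + z' + x' <= (2 + k) * L.
  by rewrite /x /y /z /y' /z' /x' /L; lra.
have h1 : s1 * x' + (1 - s1) * x + y' + z <= L.
  by rewrite /x' /x /y' /z /L; lra.
have h1' : s1 * x' + (1 - s1) * x + s1 * y + z <= L.
  by rewrite /x' /x /y /z /L; lra.
have h1r : s1 * x' + (1 - s1) * x + y' + (1 - s1) * z' <= L.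
  by rewrite /x' /x /y' /z' /L; lra.
have h2 : s2 * y' + (1 - s2) * y + z' + x <= L.
  by rewrite /y' /y /z' /x /L; lra.
have h2' : s2 * y' + (1 - s2) * y + s2 * z + x <= L.
  by rewrite /y' /y /z /x /L; lra.
have h2r : s2 * y' + (1 - s2) * y + z' + (1 - s2) * x' <= L.
  by rewrite /y' /y /z' /x' /L; lra.
have h3 : s3 * z' + (1 - s3) * z + x' + y <= L.
  by rewrite /z' /z /x' /y /L; lra.
have h3' : s3 * z' + (1 - s3) * z + s3 * x + y <= L.
  by rewrite /z' /z /x /y /L; lra.
have h3r : s3 * z' + (1 - s3) * z + x' + (1 - s3) * y' <= L.
  by rewrite /z' /z /x' /y' /L; lra.
move: x y z y' z' x' h1 h1' h1r h2 h2' h2r h3 h3' h3r => x y z y' z' x'.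
clearbody L; clear -k0 kE L0 s1P s2P s3P.
move=> h1 h1' h1r h2 h2' h2r h3 h3' h3r.
have kL0 : 0 <= k * L by rewrite mulr_ge0.
have between (s u v : R) : 0 <= s <= 1 ->
    (u <= v -> u <= s * u + (1 - s) * v) /\
    (v <= u -> v <= s * u + (1 - s) * v).
  move=> /andP[s_ge0 s_le1]; split=> uv.
    have s'_ge0 : 0 <= 1 - s by lra.
    by have := ler_wpM2l s'_ge0 uv; lra.
  by have := ler_wpM2l s_ge0 uv; lra.
have [m1 m1'] := between s1 x' x s1P; have [m2 m2'] := between s2 y' y s2P.
have [m3 m3'] := between s3 z' z s3P.
have onem (s : R) : 0 <= s <= 1 -> 0 <= 1 - s <= 1 by lra.
(* When the signs of [x - x'], [y - y'], [z - z'] are mixed, two of [h1], [h2]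
   and [h3] add up to a bound by [2 * L]. *)
have [/[dup] /m1 {}m1 xx|/ltW /[dup] /m1' {}m1' xx] := lerP x' x;
  have [/[dup] /m2 {}m2 yy|/ltW /[dup] /m2' {}m2' yy] := lerP y' y;
  have [/[dup] /m3 {}m3 zz|/ltW /[dup] /m3' {}m3' zz] := lerP z' z; try lra.
  exact: (@cyclic_bound _ k L x y z y' z' x' s1 s2 s3).
(* The opposite orientation: exchange the last two members and directions. *)
rewrite (_ : _ + x' = x' + z' + y' + z + y + x); last by ring.
by apply: (@cyclic_bound _ k L x' z' y' z y x (1 - s1) (1 - s3) (1 - s2)) => //;
  first [exact: onem | lra].
Qed.

(** Passes from the covering constant mu to the constant k in terms of which
    [trace_le] is stated. *)
Lemma ratio_identities (R : realType) (mu : R) (k := (3 * Num.sqrt 3 - 5) / 4) :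
  mu = 2 / 3 + 2 / (3 * Num.sqrt 3) ->
  [/\ 0 <= k, 8 * k ^+ 2 + 20 * k = 1, 1 < mu & mu * (1 - k) = 1].
Proof.
have q2 : (Num.sqrt 3 : R) ^+ 2 = 3 by rewrite sqr_sqrtr.
have q0 : 0 < (Num.sqrt 3 : R) by rewrite sqrtr_gt0.
rewrite /k; move: (Num.sqrt 3) q2 q0 => q q2 q0 ->.
have q_lb : 5 / 3 <= q.
  by rewrite leNgt; apply/negP => q_lt; nra.
have q_ub : q < 2 by rewrite ltNge; apply/negP => q_gt; nra.
split; first by lra.
- by rewrite !expr2; lra.
- rewrite (_ : 2 / 3 + _ = 2 * (q + 1) / (3 * q)).
  2: by field; rewrite gt_eqF.
  by rewrite ltr_pdivlMr; lra.
- apply: (@mulIf _ q); first by rewrite gt_eqF.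
  transitivity ((2 * q + 3 - q ^+ 2) / 2); first by field; rewrite gt_eqF.
  by rewrite q2; field.
Qed.

(** * Dot product and nearest points *)

Definition dot (R : realType) n (u v : 'rV[R]_n) : R := \sum_i u 0 i * v 0 i.

Section Dot.
Variables (R : realType) (n : nat).
Implicit Types u v w : 'rV[R]_n.

Lemma dotC u v : dot u v = dot v u.
Proof. by apply: eq_bigr => i _; rewrite mulrC. Qed.

Lemma dotDr u v w : dot u (v + w) = dot u v + dot u w.
Proof. by rewrite -big_split; apply: eq_bigr => i _; rewrite !mxE mulrDr. Qed.

Lemma dotZr u a v : dot u (a *: v) = a * dot u v.
Proof. by rewrite mulr_sumr; apply: eq_bigr => i _; rewrite !mxE mulrCA. Qed.

Lemma dotBr u v w : dot u (v - w) = dot u v - dot u w.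
Proof. by rewrite -[- w]scaleN1r dotDr dotZr mulN1r. Qed.

Lemma dotDl u v w : dot (v + w) u = dot v u + dot w u.
Proof. by rewrite dotC dotDr !(dotC u). Qed.

Lemma dotZl u a v : dot (a *: v) u = a * dot v u.
Proof. by rewrite dotC dotZr dotC. Qed.

Lemma dotNl u v : dot (- v) u = - dot v u.
Proof. by rewrite -scaleN1r dotZl mulN1r. Qed.

Lemma dot_ge0 u : 0 <= dot u u.
Proof. by apply: sumr_ge0 => i _; rewrite -expr2 sqr_ge0. Qed.

Lemma dot_gt0 u : u != 0 -> 0 < dot u u.
Proof.
move=> u0; rewrite lt_neqAle dot_ge0 andbT eq_sym.
apply: contraNneq u0 => /psumr_eq0P u20; apply/eqP/rowP => i; rewrite mxE.
apply/eqP; rewrite -sqrf_eq0 expr2; apply/eqP/u20 => // j _.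
by rewrite -expr2 sqr_ge0.
Qed.

End Dot.

Lemma dot_suml (R : realType) n I (r : seq I) (f : I -> 'rV[R]_n) v :
  dot (\sum_(i <- r) f i) v = \sum_(i <- r) dot (f i) v.
Proof.
apply: (big_morph (fun u => dot u v)) => [u w|]; first exact: dotDl.
by rewrite -(scale0r v) dotZl mul0r.
Qed.

Lemma dot_row_mx (R : realType) m n (a c : 'rV[R]_m) (b d : 'rV[R]_n) :
  dot (row_mx a b) (row_mx c d) = dot a c + dot b d.
Proof.
rewrite /dot big_split_ord; congr (_ + _); apply: eq_bigr => i _.
  by rewrite !row_mxEl.
by rewrite !row_mxEr.
Qed.

Lemma dot2 (R : realType) (u v : 'rV[R]_2) :
  dot u v = u 0 0 * v 0 0 + u 0 1 * v 0 1.
Proof.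
rewrite /dot !big_ord_recl big_ord0 addr0.
by rewrite (_ : lift ord0 ord0 = 1) //; exact: val_inj.
Qed.

Lemma slope_ge0 (R : realType) (b q : R) : 0 <= q ->
  (forall l, 0 <= l <= 1 -> 0 <= 2 * l * b + l ^+ 2 * q) -> 0 <= b.
Proof.
move=> q0 H; rewrite leNgt; apply/negP => b0.
have qb : 0 < q - b by lra.
(* If [b] were negative, the quadratic would be negative at this point. *)
have l01 : 0 <= - b / (q - b) <= 1.
  by rewrite divr_ge0 ?ler_pdivrMr //; lra.
have := H _ l01.
have -> : 2 * (- b / (q - b)) * b + (- b / (q - b)) ^+ 2 * q =
    - (b ^+ 2 * (q - 2 * b) / (q - b) ^+ 2) by field; rewrite gt_eqF.
rewrite oppr_ge0 leNgt => /negP; apply.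
have b2 : 0 < b ^+ 2 by rewrite -sqrrN exprn_gt0 // oppr_gt0.
by rewrite divr_gt0 ?exprn_gt0 // mulr_gt0 //; lra.
Qed.

(** The point of the compact convex image of A nearest to the origin is the
    normal of a separating hyperplane.  The parametrization phi lets the
    compactness of Minkowski sums and of joins of convex sets come from that of
    products. *)
Lemma nearest_point (R : realType) (T : topologicalType) (n : nat) (A : set T)
    (phi : T -> 'rV[R]_n) :
  A !=set0 -> compact A -> (forall i, continuous (fun t => phi t 0 i)) ->
  (forall t u s, A t -> A u -> 0 <= s <= 1 ->
     exists2 v, A v & phi v = (1 - s) *: phi t + s *: phi u) ->
  (forall t, A t -> phi t != 0) ->
  exists c, [/\ A c, 0 < dot (phi c) (phi c) &
    forall t, A t -> dot (phi c) (phi c) <= dot (phi c) (phi t)].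
Proof.
move=> A0 cA cphi convA nz.
pose f t := dot (phi t) (phi t).
have cf : continuous f.
  move=> t; apply: cvg_big => //.
    by move=> x; apply: continuousD; [exact: cvg_fst|exact: cvg_snd].
  by move=> i _; apply: continuousM; exact: cphi.
have [c /set_mem Ac cmin] := compact_EVT_min A0 cA (continuous_subspaceT cf).
exists c; split=> //; first by rewrite dot_gt0 // nz.
move=> t At; rewrite -subr_ge0 -dotBr.
apply: (slope_ge0 (dot_ge0 (phi t - phi c))) => l l01.
have [v Av vE] := convA c t l Ac At l01.
have := cmin v (mem_set Av); rewrite /f -subr_ge0 vE; congr (is_true (0 <= _)).
rewrite (_ : _ + _ *: _ = phi c + l *: (phi t - phi c)); last first.
  by rewrite scalerBr scalerBl scale1r addrAC addrA.
move: (phi t - phi c) => w.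
by rewrite dotDl !dotDr !dotZl !dotZr (dotC w); ring.
Qed.

(** * Convex sets, hulls and lines in the plane *)

Lemma convex_setP (R : realType) (M : lmodType R) (A : set M) :
  @convex_set R M A <-> forall x y (s : R), A x -> A y -> 0 <= s <= 1 ->
    A ((1 - s) *: x + s *: y).
Proof.
split=> cA x y.
  move=> s Ax Ay /andP[s0 s1].
  have /set_mem := cA y x (Itv01 s0 s1) (mem_set Ay) (mem_set Ax).
  by rewrite /conv /= addrC.
move=> l /set_mem Ax /set_mem Ay; apply/mem_set.
rewrite /conv /= addrC; rewrite {1}/unstable.onem; apply: cA => //.
by rewrite ge0 le1.
Qed.

Definition mix (R : realType) (V : lmodType R) (u v : V) (s : R) : V :=
  (1 - s) *: u + s *: v.

(** Convexity as the inclusion of a K + b K in (a + b) K; positive homothetic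
    copies of K are added through it. *)
Lemma convex_set_scale (R : realType) (M : lmodType R) (K : set M) (a b : R)
    (k k' : M) :
  @convex_set R M K -> K k -> K k' -> 0 <= a -> 0 <= b -> 0 < a + b ->
  exists2 k'', K k'' & (a + b) *: k'' = a *: k + b *: k'.
Proof.
move=> /convex_setP cK Kk Kk' a0 b0 ab0.
exists ((1 - b / (a + b)) *: k + (b / (a + b)) *: k').
  apply: cK => //; rewrite divr_ge0 ?ler_pdivrMr ?(ltW ab0) //; lra.
have abn0 : a + b != 0 by rewrite gt_eqF.
by rewrite scalerDr !scalerA; congr (_ *: _ + _ *: _); field.
Qed.

Lemma mix_in_hull (R : realType) (A : set 'rV[R]_2) u v s :
  A u -> A v -> 0 <= s <= 1 -> convex_hull A (mix u v s).
Proof.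
move=> Au Av s01 C [/convex_setP cC AC].
by apply: cC => //; exact: AC.
Qed.

Definition perp (R : realType) (v : 'rV[R]_2) : 'rV[R]_2 :=
  \row_m (if m == 0 then - v 0 1 else v 0 0).

Lemma dot_perp_line (R : realType) (a v z : 'rV[R]_2) :
  v != 0 -> dot (perp v) z = dot (perp v) a -> exists t, a + t *: v = z.
Proof.
move=> v0 /eqP; rewrite -subr_eq0 -dotBr => /eqP E.
have vv : 0 < dot v v := dot_gt0 v0.
exists (dot v (z - a) / dot v v).
suff -> : (dot v (z - a) / dot v v) *: v = z - a by rewrite addrC subrK.
move: (z - a) E vv => d; rewrite !dot2 !mxE /= => E vv.
have vv0 : v 0 0 * v 0 0 + v 0 1 * v 0 1 != 0 by rewrite gt_eqF.
apply/rowP => m; rewrite !mxE; apply: (mulIf vv0).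
rewrite mulrAC divfK //.
have [->|->] : m = 0 \/ m = 1.
  by case: m => [[|[|]]] // ?; [left|right]; exact: val_inj.
- transitivity ((v 0 0 * v 0 0 + v 0 1 * v 0 1) * d 0 0 +
    v 0 1 * (- v 0 1 * d 0 0 + v 0 0 * d 0 1)); first by ring.
  by rewrite E mulr0 addr0 mulrC.
- transitivity ((v 0 0 * v 0 0 + v 0 1 * v 0 1) * d 0 1 -
    v 0 0 * (- v 0 1 * d 0 0 + v 0 0 * d 0 1)); first by ring.
  by rewrite E mulr0 subr0 mulrC.
Qed.

Lemma convex_halfplane (R : realType) (w : 'rV[R]_2) (b : R) :
  convex_set [set z : 'rV[R]_2 | b < dot w z].
Proof.
apply/convex_setP => x y s /= bx by_ /andP[s0 s1].
rewrite dotDr !dotZr; have [->|s_neq0] := eqVneq s 0.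
  by rewrite subr0 mul1r mul0r addr0.
have := ler_wpM2l (_ : 0 <= 1 - s) (ltW bx); rewrite subr_ge0 => /(_ s1).
have s_gt0 : 0 < s by rewrite lt_neqAle eq_sym s_neq0.
have : s * b < s * dot w y by rewrite ltr_pM2l.
lra.
Qed.

(** * Non-separability *)

(** The join of F_j and F_l is the union of the homothets of K whose centres and
    ratios interpolate linearly, so membership needs a single point k' of K.  If
    F_i misses this join, the perpendicular bisector of a shortest connecting
    segment is a line that contradicts non-separability. *)
Lemma ns_members_meet (R : realType) (K : set 'rV[R]_2)
    (F : 'I_3 -> set 'rV[R]_2) (x : 'I_3 -> 'rV[R]_2) (tau : 'I_3 -> R)
    (i j l : 'I_3) :
  convex_body K -> ns_family K F ->
  (forall m, 0 < tau m) -> (forall m, F m = homothet K (x m) (tau m)) ->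
  (forall m, [\/ m = i, m = j | m = l]) ->
  exists k k' s, [/\ K k, K k', 0 <= s <= 1 &
    x i + tau i *: k = mix (x j) (x l) s + ((1 - s) * tau j + s * tau l) *: k'].
Proof.
move=> [cptK cvxK intK] [_ _ nsF] tau0 FE ijl.
have cK := (@convex_setP _ _ K).1 cvxK.
apply: contrapT => nomeet.
pose T s := (1 - s) * tau j + s * tau l.
have T0 s : 0 <= s <= 1 -> 0 < T s.
  move=> /andP[s0 s1]; rewrite /T; have [->|s_neq0] := eqVneq s 0.
    by rewrite mul0r addr0 subr0 mul1r.
  rewrite ltr_wpDl ?mulr_ge0 ?subr_ge0 ?(ltW (tau0 _)) // mulr_gt0 //.
  by rewrite lt_neqAle eq_sym s_neq0.
(* [phi] parametrizes the difference of [F i] and the join of [F j], [F l]. *)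
pose phi (p : 'rV[R]_2 * 'rV[R]_2 * R) : 'rV[R]_2 :=
  x i + tau i *: p.1.1 - (mix (x j) (x l) p.2 + T p.2 *: p.1.2).
pose A : set ('rV[R]_2 * 'rV[R]_2 * R) := (K `*` K) `*` `[0, 1]%classic.
have [k0 Kk0] : K !=set0 by case: intK => k0 /interior_subset; exists k0.
have A0 : A !=set0 by exists (k0, k0, 0); rewrite /A /= in_itv /= lexx ler01.
have cA : compact A.
  by apply: compact_setX; [exact: compact_setX|exact: segment_compact].
have cphi m : continuous (fun p => phi p 0 m).
  have -> : (fun p => phi p 0 m) = (fun p => x i 0 m + tau i * p.1.1 0 m
      - ((1 - p.2) * x j 0 m + p.2 * x l 0 m + T p.2 * p.1.2 0 m)).
    by apply/funext => p; rewrite /phi /mix !mxE.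
  have cs : continuous (fun p : 'rV[R]_2 * 'rV[R]_2 * R => p.2).
    by move=> p; exact: cvg_snd.
  have ck (q : _ * _ -> 'rV[R]_2) : continuous q ->
      continuous (fun p : 'rV[R]_2 * 'rV[R]_2 * R => q p.1 0 m).
    move=> cq p.
    apply: (@continuous_comp _ _ _ (q \o fst) (fun M : 'rV[R]_2 => M 0 m)).
      by apply: continuous_comp; [exact: cvg_fst|exact: cq].
    exact: coord_continuous.
  have ck1 := ck fst (fun p => cvg_fst); have ck2 := ck snd (fun p => cvg_snd).
  have cc (a : R) : continuous (fun p : 'rV[R]_2 * 'rV[R]_2 * R => a).
    by move=> p; exact: cvg_cst.
  move=> p; apply: cvgB.
    by apply: cvgD; [exact: cc|apply: cvgM; [exact: cc|exact: ck1]].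
  have cm (a b : R) : continuous (fun p : 'rV[R]_2 * 'rV[R]_2 * R =>
      (1 - p.2) * a + p.2 * b).
    move=> q; apply: cvgD; apply: cvgM; try exact: cc; try exact: cs.
    by apply: cvgB; [exact: cc|exact: cs].
  by apply: cvgD; [exact: cm|apply: cvgM; [exact: cm|exact: ck2]].
have nz p : A p -> phi p != 0.
  case: p => [[k k'] s] [[/= Kk Kk']]; rewrite in_itv /= => s01.
  rewrite subr_eq0; apply: contra_not_neq nomeet => E.
  by exists k, k', s.
have cvxA p q r : A p -> A q -> 0 <= r <= 1 ->
    exists2 v, A v & phi v = (1 - r) *: phi p + r *: phi q.
  case: p q => [[k k'] s] [[u u'] s'] [[/= Kk Kk']]; rewrite in_itv /= => s01.
  move=> [[/= Ku Ku']]; rewrite in_itv /= => s01' r01.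
  have rs01 : 0 <= (1 - r) * s + r * s' <= 1.
    have /andP[r0 r1] := r01; have /andP[s0 s1] := s01.
    have /andP[s0' s1'] := s01'; rewrite -subr_ge0 in r1.
    have := ler_wpM2l r1 s1; have := ler_wpM2l r0 s1'.
    by rewrite addr_ge0 ?mulr_ge0 //=; lra.
  have [||| k'' Kk'' E] :=
    @convex_set_scale R _ K ((1 - r) * T s) (r * T s') k' u' cvxK Kk' Ku'.
  + by rewrite mulr_ge0 ?(ltW (T0 _ _)) // subr_ge0; case/andP: r01.
  + by rewrite mulr_ge0 ?(ltW (T0 _ _)) //; case/andP: r01.
  + by have := T0 _ rs01; rewrite /T; lra.
  have TE : T ((1 - r) * s + r * s') = (1 - r) * T s + r * T s'.
    by rewrite /T; ring.
  exists ((1 - r) *: k + r *: u, k'', (1 - r) * s + r * s').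
    by split; [split => //=; exact: cK|rewrite /= in_itv].
  rewrite /phi /= TE E; apply/rowP => m; rewrite /mix !mxE; ring.
have [[[k1 k2] s] [[[/= Kk1 Kk2]]]] := nearest_point A0 cA cphi cvxA nz.
rewrite in_itv /= => s01.
set w := phi _ => w0 wmin.
pose y := x i + tau i *: k1; pose g := mix (x j) (x l) s + T s *: k2.
have Fi_le z : F i z -> dot w y <= dot w z.
  rewrite FE => -[k Kk <-].
  have /wmin : A (k, k2, s) by split; [split|rewrite /= in_itv].
  by rewrite {2 4}/w /phi /= !dotBr lerD2r.
have Fj_le z : F j z -> dot w z <= dot w g.
  rewrite FE => -[k Kk <-].
  have /wmin : A (k1, k, 0) by split; [split|rewrite /= in_itv /= lexx ler01].
  rewrite {2 4}/w /phi /= !(dotBr w) lerD2l lerN2.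
  by rewrite /T /mix !subr0 !scale1r !mul1r scale0r mul0r !addr0.
have Fl_le z : F l z -> dot w z <= dot w g.
  rewrite FE => -[k Kk <-].
  have /wmin : A (k1, k, 1) by split; [split|rewrite /= in_itv /= lexx ler01].
  rewrite {2 4}/w /phi /= !(dotBr w) lerD2l lerN2.
  by rewrite /T /mix !subrr !scale1r !mul1r scale0r mul0r !add0r.
have yg : dot w g < dot w y by rewrite -subr_gt0 -dotBr.
pose v := perp w.
have wv : dot w v = 0.
  by rewrite dot2 !mxE /=; ring.
have v_neq0 : v != 0.
  apply: contraTneq w0 => /rowP v0; rewrite dot2.
  have := v0 0; have := v0 1; rewrite !mxE /= => -> /eqP.
  by rewrite oppr_eq0 => /eqP ->; rewrite !mul0r addr0 ltxx.
(* The line through [m] with direction [v] strictly separates [F i] from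
   [F j] and [F l]. *)
pose m := mix y g (1 / 2).
have wm : dot w m = (dot w y + dot w g) / 2.
  by rewrite /m /mix dotDr !dotZr; field.
have hull_m : convex_hull (\bigcup_n F n) m.
  move=> C [cvxC FC].
  have cC := (@convex_setP _ _ C).1 cvxC.
  apply: (cC y g); last by lra.
    by apply: FC; exists i => //; rewrite FE; exists k1.
  have -> : g = mix (x j + tau j *: k2) (x l + tau l *: k2) s.
    by apply/rowP => n; rewrite /g /T /mix !mxE; ring.
  apply: (cC) => //.
    by apply: FC; exists j => //; rewrite FE; exists k2.
  by apply: FC; exists l => //; rewrite FE; exists k2.
have [|| n [z [[t _ <-]]]] := nsF [set m + t *: v | t in [set: R]].
- by exists m, v.
- by exists m; split=> //; exists 0 => //; rewrite scale0r addr0.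
have wz : dot w (m + t *: v) = (dot w y + dot w g) / 2.
  by rewrite dotDr dotZr wv mulr0 addr0.
by case: (ijl n) => ->; [move/Fi_le|move/Fj_le|move/Fl_le]; rewrite wz; lra.
Qed.

(** A line L that misses every member leaves each of them, by convexity, on one
    side.  They are not all on the same side, as L meets the hull of their
    union; and with three members, one would be alone on its side, away from
    the hull of the other two. *)
Lemma three_meets_ns (R : realType) (F : 'I_3 -> set 'rV[R]_2)
    (L : set 'rV[R]_2) :
  (forall i, convex_set (F i)) ->
  (forall i, exists2 g, F i g & convex_hull (\bigcup_(j in [set~ i]) F j) g) ->
  line L -> L `&` convex_hull (\bigcup_i F i) !=set0 ->
  exists i, L `&` F i !=set0.
Proof.
move=> cvxF meetF [a [v [v0 ->]]] [h [[t _ hE] hull_h]].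
apply: contrapT => /forallNP Lmiss.
pose w := perp v; pose b := dot w a.
have wv : dot w v = 0 by rewrite dot2 !mxE /=; ring.
have wh : dot w h = b by rewrite -hE dotDr dotZr wv mulr0 addr0.
have off i z : F i z -> dot w z != b.
  move=> Fz; apply: contra_not_neq (Lmiss i) => /(dot_perp_line v0)[t' zE].
  by exists z; split=> //; exists t'.
have side i : (F i `<=` [set z | b < dot w z]) \/
    (F i `<=` [set z | - b < dot (- w) z]).
  have [g Fg _] := meetF i; have cF := (convex_setP (F i)).1 (cvxF i).
  have cross z z' : F i z -> F i z' -> dot w z < b -> b < dot w z' -> False.
    move=> Fz Fz' zb bz'; pose s := (b - dot w z) / (dot w z' - dot w z).
    have zz' : 0 < dot w z' - dot w z by rewrite subr_gt0 (lt_trans zb).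
    have s01 : 0 <= s <= 1.
      by rewrite divr_ge0 ?ler_pdivrMr ?(ltW zz') //; lra.
    have /off/eqP[] := cF z z' s Fz Fz' s01.
    by rewrite dotDr !dotZr /s; field; rewrite gt_eqF.
  have /lt_total/orP[gb|bg] := off i g Fg; [right|left] => z Fz /=.
    rewrite dotNl ltrN2; have /lt_total/orP[//|] := off i z Fz.
    by move/(cross g z Fg Fz gb).
  by have /lt_total/orP[|//] := off i z Fz; move/(cross z g Fz Fg) => /(_ bg).
(* Stated for both sides of [L] at once: the other members cannot all lie on
   the side of [w'], for then [F i] would lie there too. *)
have others_split w' b' i : dot w' h = b' ->
    (forall j, F j `<=` [set z | b' < dot w' z] \/
               F j `<=` [set z | - b' < dot (- w') z]) ->
    ~ forall j, j != i -> F j `<=` [set z | b' < dot w' z].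
  move=> w'h side' others; have cH := @convex_halfplane _ w' b'.
  have [g Fg hull_g] := meetF i.
  have bg : b' < dot w' g.
    apply: (hull_g _ (conj cH _)).
    by apply: bigcup_sub => j /= /eqP; exact: others.
  have Fpos j : F j `<=` [set z | b' < dot w' z].
    have [->|/others //] := eqVneq j i; case: (side' i) => // /(_ g Fg) /=.
    by rewrite dotNl ltrN2 ltNge (ltW bg).
  have := hull_h _ (conj cH (bigcup_sub (fun j _ => Fpos j))).
  by rewrite /= w'h ltxx.
have split_pos i := @others_split w b i wh side.
have split_neg i : ~ forall j, j != i -> F j `<=` [set z | - b < dot (- w) z].
  apply: others_split; first by rewrite dotNl wh.
  by move=> j; rewrite !opprK; case: (side j); [right|left].
case: (side i1) => sd1; case: (side i2) => sd2; case: (side i3) => sd3.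
- by apply: (split_pos i1) => j; case: (ord3P j) => ->.
- by apply: (split_pos i3) => j; case: (ord3P j) => ->.
- by apply: (split_pos i2) => j; case: (ord3P j) => ->.
- by apply: (split_neg i1) => j; case: (ord3P j) => ->.
- by apply: (split_pos i1) => j; case: (ord3P j) => ->.
- by apply: (split_neg i2) => j; case: (ord3P j) => ->.
- by apply: (split_neg i3) => j; case: (ord3P j) => ->.
- by apply: (split_neg i1) => j; case: (ord3P j) => ->.
Qed.

(** * The constant suffices *)

(** With y_i ranging over C_i = x_i - kap_i K, the points
    (y_1 - y_3, y_2 - y_3) of R^4 form a compact convex set that contains the
    origin exactly when the C_i have a common point.  A separating normal
    (n_1, n_2) is completed by n_3 = - (n_1 + n_2); as the separating inequality
    is tight at the nearest point, each k_i there maximizes n_i over K. *)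
Lemma common_point_or_normals (R : realType) (K : set 'rV[R]_2)
    (x : 'I_3 -> 'rV[R]_2) (kap : 'I_3 -> R) :
  convex_body K -> (forall i, 0 < kap i) ->
  ~ (exists y : 'rV[R]_2, forall i, exists2 k, K k & y = x i - kap i *: k) ->
  exists n k : 'I_3 -> 'rV[R]_2,
    [/\ \sum_i n i = 0, forall i, K (k i),
        forall i u, K u -> dot (n i) u <= dot (n i) (k i) &
        0 < \sum_i dot (n i) (x i - kap i *: k i)].
Proof.
move=> [cptK cvxK intK] kap0 nocommon.
have cK := (@convex_setP _ _ K).1 cvxK.
pose y i (k : 'rV[R]_2) : 'rV[R]_2 := x i - kap i *: k.
pose phi (p : 'rV[R]_2 * 'rV[R]_2 * 'rV[R]_2) : 'rV[R]_(2 + 2) :=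
  row_mx (y i1 p.1.1 - y i3 p.2) (y i2 p.1.2 - y i3 p.2).
pose A : set ('rV[R]_2 * 'rV[R]_2 * 'rV[R]_2) := (K `*` K) `*` K.
have [k0 Kk0] : K !=set0 by case: intK => k0 /interior_subset; exists k0.
have A0 : A !=set0 by exists (k0, k0, k0).
have cA : compact A by do 2?apply: compact_setX.
have cphi m : continuous (fun p => phi p 0 m).
  have cy i (q : _ * _ * _ -> 'rV[R]_2) a : continuous q ->
      continuous (fun p : 'rV[R]_2 * 'rV[R]_2 * 'rV[R]_2 => y i (q p) 0 a).
    move=> cq p.
    have -> : (fun p => y i (q p) 0 a) = (fun p => x i 0 a - kap i * q p 0 a).
      by apply/funext => p'; rewrite !mxE.
    apply: cvgB; first exact: cvg_cst.
    apply: cvgM; first exact: cvg_cst.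
    apply: (@continuous_comp _ _ _ q (fun M : 'rV[R]_2 => M 0 a)).
      exact: cq.
    exact: coord_continuous.
  have c1 : continuous (fun p : 'rV[R]_2 * 'rV[R]_2 * 'rV[R]_2 => p.1.1).
    by move=> p; apply: continuous_comp; exact: cvg_fst.
  have c2 : continuous (fun p : 'rV[R]_2 * 'rV[R]_2 * 'rV[R]_2 => p.1.2).
    by move=> p; apply: continuous_comp; [exact: cvg_fst|exact: cvg_snd].
  have c3 : continuous (fun p : 'rV[R]_2 * 'rV[R]_2 * 'rV[R]_2 => p.2).
    by move=> p; exact: cvg_snd.
  case: (split_ordP m) => a ->.
    rewrite (_ : (fun _ => _) = (fun p => y i1 p.1.1 0 a - y i3 p.2 0 a)).
      by move=> p; apply: cvgB; [exact: (cy i1 _ a c1)|exact: (cy i3 _ a c3)].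
    by apply/funext => p'; rewrite /phi row_mxEl !mxE.
  rewrite (_ : (fun _ => _) = (fun p => y i2 p.1.2 0 a - y i3 p.2 0 a)).
    by move=> p; apply: cvgB; [exact: (cy i2 _ a c2)|exact: (cy i3 _ a c3)].
  by apply/funext => p'; rewrite /phi row_mxEr !mxE.
have nz p : A p -> phi p != 0.
  case: p => [[k k'] k''] [[/= Kk Kk'] Kk'']; apply: contra_not_neq nocommon.
  rewrite /phi -row_mx0 => /eq_row_mx[] /= /eqP; rewrite subr_eq0 => /eqP E1.
  move=> /eqP; rewrite subr_eq0 => /eqP E2.
  exists (y i3 k'') => i; case: (ord3P i) => ->.
  - by exists k.
  - by exists k'.
  - by exists k''.
have cvxA p q r : A p -> A q -> 0 <= r <= 1 ->
    exists2 v, A v & phi v = (1 - r) *: phi p + r *: phi q.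
  case: p q => [[k k'] k''] [[u u'] u''] [[/= Kk Kk'] Kk''].
  move=> [[/= Ku Ku'] Ku''] r01.
  exists (mix k u r, mix k' u' r, mix k'' u'' r).
    by split; [split|]; exact: cK.
  rewrite /phi /= !scale_row_mx add_row_mx; congr row_mx; apply/rowP => m;
    by rewrite /y /mix !mxE; ring.
have [[[k1 k2] k3] [[[/= Kk1 Kk2] Kk3] w0 wmin]] :=
  nearest_point A0 cA cphi cvxA nz.
set w := phi (k1, k2, k3) in w0 wmin.
pose n1 := @lsubmx _ 1 2 2 w; pose n2 := @rsubmx _ 1 2 2 w.
have wE p : dot w (phi p) =
    dot n1 (y i1 p.1.1) + dot n2 (y i2 p.1.2) + dot (- (n1 + n2)) (y i3 p.2).
  rewrite -(hsubmxK w) dot_row_mx -/n1 -/n2.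
  move: (y i1 _) (y i2 _) (y i3 _) => y1 y2 y3.
  by rewrite !dotBr dotNl dotDl; ring.
pose pick (V : Type) (a b c : V) (i : 'I_3) := nth a [:: a; b; c] i.
exists (pick _ n1 n2 (- (n1 + n2))), (pick _ k1 k2 k3); split.
- by rewrite sum3 /pick /= subrr.
- by move=> i; case: (ord3P i) => ->.
- have ymax i n (a b : 'rV[R]_2) :
      dot n (y i a) <= dot n (y i b) -> dot n b <= dot n a.
    by rewrite !(dotBr, dotZr) lerD2l lerN2 ler_pM2l.
  move=> i u Ku; case: (ord3P i) => ->; rewrite /pick /=.
  + by have /wmin := (conj (conj Ku Kk2) Kk3 : A (u, k2, k3));
      rewrite /w !wE /= !lerD2r => /ymax.
  + by have /wmin := (conj (conj Kk1 Ku) Kk3 : A (k1, u, k3));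
      rewrite /w !wE /= lerD2r lerD2l => /ymax.
  + by have /wmin := (conj (conj Kk1 Kk2) Ku : A (k1, k2, u));
      rewrite /w !wE /= lerD2l => /ymax.
- by rewrite sum3 /pick /=; move: w0; rewrite {2}/w wE.
Qed.

Lemma covering_constant_upper (R : realType) :
  ns3_covering_constant (2 / 3 + 2 / (3 * Num.sqrt 3) : R).
Proof.
move=> K F tau cbK nsF hom.
have [kk0 kkE mu1 mu_kk] :=
  ratio_identities (erefl (2 / 3 + 2 / (3 * Num.sqrt 3) : R)).
move: (2 / 3 + _) (_ / 4) kk0 kkE mu1 mu_kk => mu kk kk0 kkE mu1 mu_kk.
have tau0 i : 0 < tau i by case: (hom i).
have /choice[x FE] i : exists v, F i = homothet K v (tau i) by case: (hom i).
have [cptK cvxK intK] := cbK.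
set tot := \sum_i tau i; pose lam := mu * tot.
have tau_le i : tau i <= tot.
  by rewrite /tot (bigD1 i) //= lerDl sumr_ge0 // => j _; exact: ltW.
have tot0 : 0 < tot by exact: lt_le_trans (tau_le ord0).
have lam_gt : tot < lam by rewrite /lam -[ltLHS]mul1r ltr_pM2r.
pose kap i := lam - tau i.
have kap0 i : 0 < kap i by rewrite subr_gt0 (le_lt_trans (tau_le i)).
(* As [lam = kap i + tau i], a common point of the sets [x i - kap i K] is the
   base point of a translate of [lam K] that contains every [F i]. *)
suff [y yP] : exists y : 'rV[R]_2,
    forall i, exists2 k, K k & y = x i - kap i *: k.
  exists y => z [i _]; rewrite FE => -[k Kk <-].
  have [k' Kk' yE] := yP i.
  have kt0 : 0 < kap i + tau i by rewrite addr_gt0.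
  have [k'' Kk'' E] :=
    convex_set_scale cvxK Kk' Kk (ltW (kap0 i)) (ltW (tau0 i)) kt0.
  have -> : mu * tot = kap i + tau i by rewrite /kap subrK.
  exists k'' => //.
  by rewrite E yE addrA subrK.
apply: contrapT => /(common_point_or_normals cbK kap0) [n [k [n0 Kk kmax pos]]].
pose h r := dot (n r) (k r).
have ndot0 v : \sum_r dot (n r) v = 0.
  by rewrite -dot_suml n0 -(scale0r v) dotZl mul0r.
have H0 : 0 <= \sum_r h r.
  by rewrite -[leLHS](ndot0 (k ord0)); apply: ler_sum => r _; exact: kmax.
(* The support value of [F j] in direction [n r]. *)
pose t r j := dot (n r) (x j) + tau j * h r.
have tP i j l : (forall m, [\/ m = i, m = j | m = l]) -> support_meets t i j l.
  move=> ijl.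
  have [u [v [s [Ku Kv s01 E]]]] := ns_members_meet cbK nsF tau0 FE ijl.
  exists s, (fun r => dot (n r) (x i + tau i *: u)); split=> // r; split.
    by rewrite dotDr dotZr /t lerD2l ler_pM2l // kmax.
  rewrite E !dotDr !dotZr /t.
  have := kmax r v Kv; rewrite -/(h r) => hv.
  have T0 : 0 <= (1 - s) * tau j + s * tau l.
    case/andP: s01 => s0 s1.
    by rewrite addr_ge0 ?mulr_ge0 ?subr_ge0 ?(ltW (tau0 _)).
  by have := ler_wpM2l T0 hv; lra.
have trE : \sum_r t r r =
    \sum_r dot (n r) (x r - kap r *: k r) + lam * \sum_r h r.
  rewrite mulr_sumr -big_split; apply: eq_bigr => r _ /=.
  by rewrite dotBr dotZr /t /kap /h; ring.
have tot_t : \sum_r \sum_j t r j = tot * \sum_r h r.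
  rewrite exchange_big /tot mulr_suml; apply: eq_bigr => j _.
  by rewrite /t big_split /= ndot0 add0r mulr_sumr.
have tr_gt : lam * \sum_r h r < \sum_r t r r by rewrite trE ltrDr.
have lamH : 0 <= lam * \sum_r h r by rewrite mulr_ge0 // ltW // (lt_trans tot0).
have := trace_le kk0 kkE tP (le_trans lamH (ltW tr_gt)).
have kk1 : 0 < 1 - kk by rewrite -(pmulr_rgt0 _ (lt_trans ltr01 mu1)) mu_kk.
rewrite tot_t leNgt => /negP; apply.
rewrite -(ltr_pM2l kk1) in tr_gt; move: tr_gt.
by rewrite /lam !mulrA (mulrC _ mu) mu_kk mul1r.
Qed.

(** * The constant is optimal *)

Definition pt (R : realType) (a b : R) : 'rV[R]_2 :=
  \row_m (if m == 0 then a else b).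

Definition corner_triangle (R : realType) (c : 'rV[R]_2) (t : R) :
    set 'rV[R]_2 :=
  [set z | [/\ c 0 0 <= z 0 0, c 0 1 <= z 0 1 &
    z 0 0 + z 0 1 <= c 0 0 + c 0 1 + t]].

Lemma corner_triangleE (R : realType) (c : 'rV[R]_2) (t : R) : 0 < t ->
  homothet (corner_triangle 0 1) c t = corner_triangle c t.
Proof.
move=> t0; apply/seteqP; split=> z /=.
  move=> [k []]; rewrite !mxE => k0 k1 k01 <-; rewrite /corner_triangle /= !mxE.
  have := mulr_ge0 (ltW t0) k0; have := mulr_ge0 (ltW t0) k1.
  have := ler_wpM2l (ltW t0) k01; split; lra.
rewrite /corner_triangle /= => -[z0 z1 z01].
exists (t^-1 *: (z - c)).
  2: by rewrite scalerA divff ?gt_eqF // scale1r addrC subrK.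
rewrite /= !mxE !add0r; split.
- by rewrite mulr_ge0 ?invr_ge0 ?(ltW t0) // subr_ge0.
- by rewrite mulr_ge0 ?invr_ge0 ?(ltW t0) // subr_ge0.
- by rewrite -mulrDr ler_pdivrMl // mulr1; lra.
Qed.

Lemma convex_corner_triangle (R : realType) (c : 'rV[R]_2) (t : R) :
  convex_set (corner_triangle c t).
Proof.
apply/convex_setP => x y s [x0 x1 x01] [y0 y1 y01] /andP[s0 s1].
rewrite -subr_ge0 in s1.
rewrite /corner_triangle /= !mxE; split.
- by have := ler_wpM2l s1 x0; have := ler_wpM2l s0 y0; lra.
- by have := ler_wpM2l s1 x1; have := ler_wpM2l s0 y1; lra.
- by have := ler_wpM2l s1 x01; have := ler_wpM2l s0 y01; lra.
Qed.

Lemma convex_body_corner_triangle (R : realType) :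
  convex_body (corner_triangle (0 : 'rV[R]_2) 1).
Proof.
split; last 2 first.
- exact: convex_corner_triangle.
- exists (pt (1/3) (1/3)); apply/nbhs_ballP; exists (1/6) => /=; first by lra.
  move=> z [_ zb]; have := zb 0 0; have := zb 0 1.
  rewrite /ball /= !mxE /= !ltr_norml => z1 z0.
  by split; rewrite ?mxE; lra.
have box : compact [set v : 'rV[R]_2 | forall i, `[0, 1]%classic (v ord0 i)].
  exact: (@rV_compact R 2 (fun=> `[0, 1]%classic)
    (fun=> @segment_compact R 0 1)).
apply: (subclosed_compact _ box).
  have cl (f : 'rV[R]_2 -> R) (B : set R) : continuous f -> closed B ->
      closed (f @^-1` B).
    by move=> cf; apply: preimage_closed => z _; exact: cf.
  have cc (i : 'I_2) : continuous (fun z : 'rV[R]_2 => z 0 i).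
    exact: coord_continuous.
  have c0 := cc 0; have c1 := cc 1.
  have c01 : continuous (fun z : 'rV[R]_2 => z 0 0 + z 0 1).
    by move=> z; exact: (continuousD (c0 z) (c1 z)).
  rewrite (_ : corner_triangle 0 1 = [set z | 0 <= z 0 0] `&`
      [set z | 0 <= z 0 1] `&` [set z | z 0 0 + z 0 1 <= 1]).
    apply: closedI; [apply: closedI|].
    - exact: (cl _ [set y | 0 <= y] c0 (@closed_ge R 0)).
    - exact: (cl _ [set y | 0 <= y] c1 (@closed_ge R 0)).
    - exact: (cl _ [set y | y <= 1] c01 (@closed_le R 1)).
  apply/seteqP; split=> z /=; rewrite /corner_triangle /= !mxE !add0r.
    by case.
  by case=> -[].
move=> z []; rewrite !mxE => z0 z1 z01 i /=; rewrite in_itv /=.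
have [->|->] : i = 0 \/ i = 1; last 2 first.
- by apply/andP; split; lra.
- by apply/andP; split; lra.
by case: i => [[|[|]]] // ?; [left|right]; exact: val_inj.
Qed.

(** Three equal triangles inscribed in the triangle u, v >= 0, u + v <= 1, each
    of which touches one of its sides.  In the coordinates u, v, 1 - u - v the
    family is invariant under cyclic shifts.  A covering copy has to reach all
    three sides, so its ratio is at least 1. *)
Lemma covering_constant_lower (R : realType) (mu : R) :
  0 <= mu -> ns3_covering_constant mu -> 2 / 3 + 2 / (3 * Num.sqrt 3) <= mu.
Proof.
move=> mu0 cover.
have [_ _ _ mu_kk] :=
  ratio_identities (erefl (2 / 3 + 2 / (3 * Num.sqrt 3) : R)).
move: (2 / 3 + _) mu_kk => nu.
have r2 : (Num.sqrt 3 : R) ^+ 2 = 3 by rewrite sqr_sqrtr.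
have r0 : 0 < (Num.sqrt 3 : R) by rewrite sqrtr_gt0.
move: (Num.sqrt 3) r2 r0 => r r2 r0 nu_r.
have r_lb : 5 / 3 <= r by rewrite leNgt; apply/negP => ?; nra.
have r_ub : r < 9 / 5 by rewrite ltNge; apply/negP => ?; nra.
(* The values of [p], [q], [s] solve [s * q = p] and [s * p = 1 - 2 * q], which
   make each triangle touch the hull of the other two; [s] is the mixing
   parameter of the point of contact. *)
pose p := r / 6; pose q := 1 / 4 + r / 12; pose s := r - 1.
pose tau := 1 - p - q.
have sq : s * q = p by rewrite /s /q /p; lra.
have sp : s * p = 1 - 2 * q by rewrite /s /q /p; lra.
have s01 : 0 <= s <= 1 by rewrite /s; lra.
have p0 : 0 < p by rewrite /p; lra.
have pq : p < q by rewrite /p /q; lra.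
have tau0 : 0 < tau by rewrite /tau /p /q; lra.
have q_ub : 2 * q <= 1 by rewrite /q; lra.
have tauE : tau * 3 = 1 - (3 * r - 5) / 4 by rewrite /tau /p /q; field.
pose c (i : 'I_3) := nth 0 [:: pt 0 p; pt q 0; pt p q] i.
pose K : set 'rV[R]_2 := corner_triangle 0 1.
pose F i := homothet K (c i) tau.
have FE i : F i = corner_triangle (c i) tau by rewrite /F corner_triangleE.
have in1 u v : 0 <= u -> p <= v -> u + v <= 1 - q -> F i1 (pt u v).
  by rewrite FE /corner_triangle /= !mxE /= /tau => *; split; lra.
have in2 u v : q <= u -> 0 <= v -> u + v <= 1 - p -> F i2 (pt u v).
  by rewrite FE /corner_triangle /= !mxE /= /tau => *; split; lra.
have in3 u v : p <= u -> q <= v -> u + v <= 1 -> F i3 (pt u v).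
  by rewrite FE /corner_triangle /= !mxE /= /tau => *; split; lra.
have ptmix u v u' v' :
    mix (pt u v) (pt u' v') s =
      pt ((1 - s) * u + s * u') ((1 - s) * v + s * v').
  by apply/rowP => m; rewrite !mxE; case: (m == 0).
have meetF i : exists2 g, F i g & convex_hull (\bigcup_(j in [set~ i]) F j) g.
  have hull j l u v : j != i -> l != i -> F j u -> F l v ->
      convex_hull (\bigcup_(j in [set~ i]) F j) (mix u v s).
    move=> ji li Fu Fv.
    by apply: mix_in_hull => //; [exists j|exists l] => //; exact/eqP.
  case: (ord3P i) hull => -> hull.
  - exists (mix (pt q 0) (pt p q) s); first by rewrite ptmix; apply: in1; lra.
    by apply: (hull i2 i3) => //; [apply: in2|apply: in3]; lra.
  - exists (mix (pt (1 - q) q) (pt (1 - p - q) p) s).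
      by rewrite ptmix; apply: in2; lra.
    by apply: (hull i3 i1) => //; [apply: in3|apply: in1]; lra.
  - exists (mix (pt 0 (1 - q)) (pt q (1 - p - q)) s).
      by rewrite ptmix; apply: in3; lra.
    by apply: (hull i1 i2) => //; [apply: in1|apply: in2]; lra.
have homF i : positive_homothet K tau (F i) by split=> //; exists (c i).
have nsF : ns_family K F.
  split; first by rewrite card_ord.
  - by move=> i; exists tau.
  - move=> L; apply: three_meets_ns => // i; rewrite FE.
    exact: convex_corner_triangle.
have [x cov] :=
  cover K F (fun=> tau) (convex_body_corner_triangle R) nsF homF.
rewrite sumr_const card_ord -mulr_natr tauE in cov.
set lam := mu * _ in cov.
have lam0 : 0 <= lam by rewrite mulr_ge0 // -tauE; lra.
have covF i z : F i z -> [/\ x 0 0 <= z 0 0, x 0 1 <= z 0 1 &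
    z 0 0 + z 0 1 <= x 0 0 + x 0 1 + lam].
  move=> Fz; have [k [+ + +] <-] : homothet K x lam z by apply: cov; exists i.
  rewrite !mxE => k0 k1 k01.
  have := mulr_ge0 lam0 k0; have := mulr_ge0 lam0 k1.
  by have := ler_wpM2l lam0 k01; split; lra.
have F1 : F i1 (pt 0 p) by apply: in1; lra.
have F2 : F i2 (pt q 0) by apply: in2; lra.
have F3 : F i3 (pt (1 - q) q) by apply: in3; lra.
have [+ _ _] := covF _ _ F1; have [_ + _] := covF _ _ F2.
have [_ _ +] := covF _ _ F3.
rewrite !mxE /= => x01 x1 x0.
have kk0 : 0 < 1 - (3 * r - 5) / 4 by rewrite -tauE; lra.
rewrite -(ler_pM2r kk0) nu_r; rewrite /lam in x01; lra.
Qed.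

(* The bound [0 <= mu] is needed: a large enough negative multiple of [K] is a
   big reflected copy of [K], so every sufficiently negative [mu] would also be
   a covering constant. *)
Theorem theorem2 (R : realType) :
  ns3_covering_constant (2 / 3 + 2 / (3 * Num.sqrt 3) : R) /\
  (forall mu : R, 0 <= mu -> ns3_covering_constant mu ->
     2 / 3 + 2 / (3 * Num.sqrt 3) <= mu).
Proof.
split; first exact: covering_constant_upper.
by move=> mu; exact: covering_constant_lower.
Qed.
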